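(* Let $s,t\ge1$ be integers. Let $v=(v_x)_{x\in\mathcal{X}_{s,t}}$ be an entrywise positive right eigenvector of the adjacency matrix $M_{s,t}$ of the directed graph $H_{s,t}$ for its eigenvalue of maximum norm. For $n\ge1$, let $\tilde\mu=\tilde\mu_n$ be the law of the Markov chain $X_1,\dots,X_n$ on $\mathcal{X}_{s,t}$ with $X_1=x^*$ and $$P(X_{i+1}=T_j(x)\mid X_i=x)=K^*(x,T_j(x))=\frac{v_{T_j(x)}}{\sum_{k} v_{T_k(x)}},$$ where $j$ and the sum over $k$ range over those indices in $\{1,\dots,t+1\}$ for which $T_j(x)$, respectively $T_k(x)$, lies in $\mathcal{X}_{s,t}$. Let $\mu^*=\mu^*_n$ be the uniform distribution on the type-$(s,t)$ sequences of length $n$ starting at $x^*$ (equivalently, on perfect matchings of the type-$(s,t)$ graph on $[n]\sqcup[n']$). Then the log-density $\log\frac{d\mu^*}{d\tilde\mu}$ is a bounded random variable under $\mu^*$, uniformly in $n$: there is a constant $C=C(s,t)$ such that for every $n\ge1$ and every type-$(s,t)$ sequence $(x_1,\dots,x_n)$ starting at $x^*$, $$\left|\log\frac{d\mu^*}{d\tilde\mu}(x_1,\dots,x_n)\right|\le C .$$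
   Context: $\mathcal{X}_{s,t}$ is the set of integer sequences $x=(n_1,\dots,n_t)$ with $s\ge n_1\ge n_2\ge\cdots\ge n_t\ge0$, and $x^*=(0,\dots,0)$. For $1\le j\le t$, $T_j(x)=(n_1+1,\dots,n_{j-1}+1,n_{j+1},\dots,n_t,0)$, and $T_{t+1}(x)=(n_1+1,\dots,n_t+1)$. If $n_1=s$, only $T_1(x)$ lies in $\mathcal{X}_{s,t}$; if $n_1<s$ then all $T_j(x)$ do. $H_{s,t}$ is the directed graph with vertex set $\mathcal{X}_{s,t}$ and an edge from $x$ to $y$ whenever $y=T_j(x)$ for some $1\le j\le t+1$; $M_{s,t}$ is its adjacency matrix ($M_{s,t}(x,y)=1$ if there is an edge from $x$ to $y$, and $0$ otherwise). A type-$(s,t)$ sequence of length $n$ starting at $x$ is a sequence $x_1,\dots,x_n\in\mathcal{X}_{s,t}$ with $x_1=x$ such that for each $i=1,\dots,n-1$ there is $j_i\in\{1,\dots,\min(t+1,n-i+1)\}$ with $x_{i+1}=T_{j_i}(x_i)$. Type-$(s,t)$ sequences of length $n$ starting at $x^*$ are in bijection with perfect matchings of the type-$(s,t)$ graph on $[n]\sqcup[n']$ (edge between $i$ and $j'$ iff $-s\le j-i\le t$). *)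

(* Defs.v *)
From HB Require Import structures.
From mathcomp Require Import all_boot all_order all_algebra.
From mathcomp Require Import complex.
From mathcomp Require Import all_classical all_reals all_analysis.

Set Implicit Arguments.
Unset Strict Implicit.
Unset Printing Implicit Defensive.

Import Order.TTheory GRing.Theory Num.Theory.
Local Open Scope ring_scope.

Record state (s t : nat) := State {
  state_tuple :> t.-tuple 'I_s.+1;
  _ : sorted geq [seq val i | i <- state_tuple] }.

HB.instance Definition _ s t := [isSub for @state_tuple s t].
HB.instance Definition _ s t := [Finite of state s t by <:].

Definition coords (s t : nat) (x : state s t) : seq nat := [seq val i | i <- x].

Lemma state0_subproof (s t : nat) :
  sorted geq [seq val i | i <- nseq_tuple t (ord0 : 'I_s.+1)].
Proof. by rewrite map_nseq; elim: t => [|[|t] IHt]. Qed.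

Definition state0 (s t : nat) : state s t := State (state0_subproof s t).

(* T_j on arbitrary sequences, with j counted from 1; the result of applying
   it to a state need not be a state, as an entry may exceed s. *)
Definition T (j : nat) (x : seq nat) : seq nat :=
  if (j <= size x)%N
  then [seq n.+1 | n <- take j.-1 x] ++ rcons (drop j x) 0%N
  else [seq n.+1 | n <- x].

(* y = T_j(x); as y is a state, this includes that T_j(x) is one. *)
Definition is_T (s t j : nat) (x y : state s t) : bool :=
  coords y == T j (coords x).

(* The index j : 'I_t.+1 stands for j.+1 in {1, ..., t+1}. *)
Definition edge (s t : nat) (x y : state s t) : bool :=
  [exists j : 'I_t.+1, is_T j.+1 x y].

Definition adjmx (F : pzRingType) (s t : nat) : 'M[F]_#|{: state s t}| :=
  \matrix_(i, j) (edge (enum_val i) (enum_val j))%:R.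

Definition state_col (F : pzRingType) (s t : nat) (v : state s t -> F) :
    'cV[F]_#|{: state s t}| :=
  \col_i v (enum_val i).

(* The spectrum is taken over the complex numbers R[i]. [eigenvalue] is defined
   through row vectors, but a square matrix and its transpose have the same
   eigenvalues. *)
Definition max_eigenvalue (R : realType) (s t : nat) (a : R[i]) : Prop :=
  eigenvalue (adjmx R[i] s t) a /\
  forall b : R[i], eigenvalue (adjmx R[i] s t) b -> `|b| <= `|a|.

Definition right_eigenvector (R : realType) (s t : nat) (a : R[i])
    (v : state s t -> R) : Prop :=
  let V := state_col (fun x => (v x)%:C%C) in
  V != 0 /\ adjmx R[i] s t *m V = a *: V.

(* The inner sum has at most one term: it is v_{T_k(x)} if T_k(x) is a state,
   and is empty otherwise. *)
Definition Kstar (R : realType) (s t : nat) (v : state s t -> R)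
    (x y : state s t) : R :=
  if edge x y
  then v y / \sum_(k < t.+1) \sum_(z : state s t | is_T k.+1 x z) v z
  else 0.

(* Joint mass function of (X_1, ..., X_n) for a Markov chain started at x0 with
   transition kernel K. The indices are shifted to start at 0, and the default
   value of nth is never reached when n > 0. *)
Definition markov_law (R : realType) (S : eqType) (x0 : S) (K : S -> S -> R)
    (n : nat) (x : n.-tuple S) : R :=
  (nth x0 x 0 == x0)%:R * \prod_(i < n.-1) K (nth x0 x i) (nth x0 x i.+1).

Definition mu_tilde (R : realType) (s t n : nat) (v : state s t -> R)
    (x : n.-tuple (state s t)) : R :=
  markov_law (state0 s t) (Kstar v) x.

(* With i counted from 0, the bound min(t+1, n-i+1) reads
   min(t+1, n-(i+1)+1). *)
Definition type_seq (s t n : nat) (x1 : state s t)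
    (x : n.-tuple (state s t)) : bool :=
  (nth x1 x 0 == x1) &&
  [forall i : 'I_n.-1, exists j : 'I_t.+1,
     (j.+1 <= minn t.+1 (n - i.+1 + 1))%N &&
     is_T j.+1 (nth x1 x i) (nth x1 x i.+1)].

Definition mu_star (R : realType) (s t n : nat)
    (x : n.-tuple (state s t)) : R :=
  if type_seq (state0 s t) x
  then #|[pred y : n.-tuple (state s t) | type_seq (state0 s t) y]|%:R^-1
  else 0.

(* Main.v *)
Require Import Defs.
From HB Require Import structures.
From mathcomp Require Import all_boot all_order all_algebra.
From mathcomp Require Import complex.
From mathcomp Require Import all_classical all_reals all_analysis.
From mathcomp Require Import zify.

Import Order.TTheory GRing.Theory Num.Theory.
Local Open Scope ring_scope.

(** The eigenvector equation says that the weights v y of the successors y of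
    x sum to lam * v x, where lam is the real part of the eigenvalue. Since the
    targets T_j(x) are distinct, this sum is the denominator of the kernel, so
    the mass of a sequence x_1, ..., x_n from the zero state x0 under the Markov
    law telescopes to v x_n / (lam ^ (n - 1) * v x0) ([mu_tilde_walk]). As the
    uniform law gives mass 1 / N_n to each of the N_n admissible sequences, the
    density is lam ^ (n - 1) * v x0 / (N_n * v x_n), and two facts bound it
    above and below.

    First, the ratios v y / v x are bounded by a constant depending on s and t
    only ([eigenfunction_ratio_le]). A step along an edge multiplies v by at
    most lam <= t + 1, and H_{s,t} is strongly connected: t steps T_1 empty any
    state, and conversely any state y is a successor of the state y' obtained
    by lowering each nonzero entry by 1, so s steps lead from x0 to y.

    Second, N_n is comparable to lam ^ (n - 1). Counting walks by their first
    step gives the recursion N_(m+1)(x) = sum of N_m(y) over the admissible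
    successors y. The function lam ^ m * v x satisfies the same recursion with
    the sum over all successors; the two sums differ only during the last few
    steps, where the bound on the index j is active, which costs at most a
    factor (t + 1) ^ t ([nwalks_le], [nwalks_ge]). *)

(** * States and the maps T_j *)

(** Reading states through the entries padded with zeros turns the deletion,
    shift and final zero of T_j into the single formula of [is_TP]. *)
Definition entry {s t : nat} (x : state s t) (i : nat) : nat :=
  nth 0%N (coords x) i.

Lemma size_coords {s t} (x : state s t) : size (coords x) = t.
Proof. by rewrite size_map size_tuple. Qed.

Lemma entry_default {s t} (x : state s t) i : (t <= i)%N -> entry x i = 0%N.
Proof. by move=> le_ti; rewrite /entry nth_default ?size_coords. Qed.

Lemma entry_le_s {s t} (x : state s t) i : (entry x i <= s)%N.
Proof.
have [lt_it|/entry_default -> //] := ltnP i t.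
by rewrite /entry (nth_map ord0) ?size_tuple // -ltnS ltn_ord.
Qed.

Lemma entryS_le {s t} (x : state s t) i : (entry x i.+1 <= entry x i)%N.
Proof.
have [lt_it|/entry_default -> //] := ltnP i.+1 t.
case: x => x x_sorted; have /(sortedP 0%N) := x_sorted.
by apply; rewrite size_map size_tuple.
Qed.

Lemma eq_state {s t} (x y : state s t) :
  (forall i, (i < t)%N -> entry x i = entry y i) -> x = y.
Proof.
move=> eq_xy; apply/val_inj/val_inj/(inj_map val_inj).
by apply: (@eq_from_nth _ 0%N) => [|i]; rewrite !size_map !size_tuple // => /eq_xy.
Qed.

Lemma entry_state0 s t i : entry (state0 s t) i = 0%N.
Proof. by rewrite /entry /coords /= map_nseq nth_nseq if_same. Qed.

Lemma ex_state {s t} {f : nat -> nat} :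
    (forall i, (f i <= s)%N) -> (forall i, (f i.+1 <= f i)%N) ->
  exists x : state s t, forall i, (i < t)%N -> entry x i = f i.
Proof.
move=> f_le_s f_dec; pose u := [tuple inord (f i) : 'I_s.+1 | i < t].
have nth_u i : (i < t)%N -> nth 0%N [seq val i | i <- u] i = f i.
  move=> lt_it; rewrite (nth_map ord0) ?size_tuple //.
  rewrite -[i in LHS]/(val (Ordinal lt_it)) -tnth_nth tnth_mktuple /=.
  by rewrite inordK // ltnS.
have u_sorted : sorted geq [seq val i | i <- u].
  apply/(sortedP 0%N) => i; rewrite size_map size_tuple => lt_it.
  by rewrite !nth_u ?(ltnW lt_it) //= f_dec.
by exists (State u_sorted).
Qed.

Lemma size_T j l : (0 < j)%N -> size (T j l) = size l.
Proof.
move=> j_gt0; rewrite /T; case: leqP => le_jl; last by rewrite size_map.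
rewrite size_cat size_map size_rcons size_takel ?size_drop; lia.
Qed.

Lemma nth_T {j l} i : (j <= size l)%N ->
  nth 0%N (T j.+1 l) i =
    if (i < j)%N then (nth 0%N l i).+1 else nth 0%N l i.+1.
Proof.
move=> le_jl; rewrite /T; case: ifP => [lt_jl|ge_jl] /=.
  rewrite nth_cat size_map size_takel //.
  case: ltnP => [lt_ij|le_ji].
    by rewrite (nth_map 0%N) ?size_takel // nth_take.
  rewrite nth_rcons size_drop nth_drop addSn subnKC //.
  case: ltnP => // le_li; rewrite if_same nth_default //; lia.
have ->: j = size l by lia.
case: ltnP => [lt_ij|le_ji]; first by rewrite (nth_map 0%N).
by rewrite !nth_default ?size_map //; lia.
Qed.

Lemma is_TP {s t} (j : 'I_t.+1) (x y : state s t) :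
  reflect (forall i, (i < t)%N ->
             entry y i = if (i < j)%N then (entry x i).+1 else entry x i.+1)
          (is_T j.+1 x y).
Proof.
have le_jt : (j <= size (coords x))%N by rewrite size_coords -ltnS.
apply: (iffP eqP) => [eq_yT i _|eq_yT]; first by rewrite /entry eq_yT nth_T.
apply: (@eq_from_nth _ 0%N) => [|i]; rewrite ?size_T // !size_coords // => lt_it.
by rewrite nth_T // -[LHS]/(entry y i) eq_yT.
Qed.

Lemma is_T_target_uniq {s t} (j : nat) (x y z : state s t) :
  is_T j x y -> is_T j x z -> y = z.
Proof.
move=> /eqP Dy /eqP Dz; apply: eq_state => i _.
by rewrite /entry Dy Dz.
Qed.

(** For j < k, the j-th entry of T_j(x) is n_(j+1), or 0 if j = t, while that
    of T_k(x) is n_j + 1, which is larger as x is nonincreasing. *)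
Lemma is_T_index_uniq {s t} (j k : 'I_t.+1) (x y : state s t) :
  is_T j.+1 x y -> is_T k.+1 x y -> j = k.
Proof.
suff lt_absurd (i l : 'I_t.+1) : is_T i.+1 x y -> is_T l.+1 x y -> ~~ (i < l)%N.
  move=> xyj xyk; apply: ord_inj; apply/eqP; rewrite eqn_leq.
  by rewrite leqNgt lt_absurd // leqNgt lt_absurd.
move=> /is_TP xyi /is_TP xyl; apply/negP => lt_il.
have lt_it : (i < t)%N by have := ltn_ord l; lia.
have := xyi i lt_it; rewrite (xyl i lt_it) lt_il ltnn => eq_S.
by have := entryS_le x i; rewrite -eq_S ltnn.
Qed.

(** * Strong connectivity of the graph *)

(** Here m is the number of steps left after this one, so that the bound
    n - i + 1 on the index j is m + 2. *)
Definition step {s t : nat} (m : nat) (x y : state s t) : bool :=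
  [exists j : 'I_t.+1, (j.+1 <= minn t.+1 m.+2)%N && is_T j.+1 x y].

Lemma step_edge {s t m} {x y : state s t} : step m x y -> edge x y.
Proof. by case/existsP => j /andP[_ xyj]; apply/existsP; exists j. Qed.

Lemma step_eq_edge {s t m} (x y : state s t) :
  (t <= m.+1)%N -> step m x y = edge x y.
Proof.
move=> le_tm; apply/idP/idP => [/step_edge //|/existsP[j xyj]].
by apply/existsP; exists j; rewrite xyj andbT; have := ltn_ord j; lia.
Qed.

(** The move T_1 is admissible at every state and however few steps are left,
    so sequences never get stuck. *)
Lemma ex_shift {s t} (x : state s t) :
  exists2 y : state s t, forall m, step m x y &
    forall i, (i < t)%N -> entry y i = entry x i.+1.
Proof.
have [y Dy] := ex_state (t := t) (fun i => entry_le_s x i.+1)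
                        (fun i => entryS_le x i.+1).
exists y => // m; apply/existsP; exists ord0; rewrite leq_min /=.
by apply/(is_TP ord0) => i lt_it; rewrite Dy.
Qed.

(** If y has c nonzero entries and x is y with these entries lowered by 1,
    then y = T_(c+1)(x): the first c entries are raised again, and the deleted
    entry and all those after it are zero. *)
Lemma ex_lower {s t} (y : state s t) :
  exists2 x : state s t, edge x y &
    forall i, (i < t)%N -> entry x i = (entry y i).-1.
Proof.
have pred_le_s i : ((entry y i).-1 <= s)%N by have := entry_le_s y i; lia.
have pred_dec i : ((entry y i.+1).-1 <= (entry y i).-1)%N.
  by have := entryS_le y i; lia.
have [x Dx] := ex_state (t := t) pred_le_s pred_dec.
exists x => //; apply/existsP.
have le_ct : (find (pred1 0%N) (coords y) < t.+1)%N.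
  by rewrite ltnS -[X in (_ <= X)%N](size_coords y) find_size.
exists (Ordinal le_ct); apply/is_TP => i lt_it /=.
case: ltnP => [lt_ic|le_ci].
  by have /negbT /= := before_find 0%N lt_ic; rewrite Dx // /entry; lia.
have y_i0 : entry y i = 0%N.
  have y_c0 : entry y (find (pred1 0%N) (coords y)) = 0%N.
    apply/eqP; apply: (@nth_find _ 0%N (pred1 0%N)).
    by rewrite has_find size_coords (leq_ltn_trans le_ci).
  elim: i le_ci {lt_it} => [|i IHi]; first by rewrite leqn0 => /eqP c0; rewrite -{1}c0.
  rewrite leq_eqVlt => /orP[/eqP <- //|/IHi y_i0].
  by have := entryS_le y i; rewrite y_i0; lia.
rewrite y_i0; have [lt_iSt|/entry_default -> //] := ltnP i.+1 t.
by rewrite Dx //; have := entryS_le y i; lia.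
Qed.

(** * Counting admissible sequences *)

Fixpoint walk {s t : nat} (x : state s t) (l : seq (state s t)) : bool :=
  if l is y :: l' then step (size l') x y && walk y l' else true.

Fixpoint nwalks {s t : nat} (m : nat) (x : state s t) : nat :=
  if m is m'.+1 then (\sum_(y | step m' x y) nwalks m' y)%N else 1%N.

Lemma walkP {s t} (d x : state s t) l :
  reflect (forall i, (i < size l)%N ->
             step (size l - i.+1) (nth d (x :: l) i) (nth d (x :: l) i.+1))
          (walk x l).
Proof.
elim: l x => [|y l IHl] x /=; first by apply: ReflectT.
apply: (iffP andP) => [[xy /IHl yl] [|i] /=|xyl]; rewrite ?subn1 // ?subSS.
  exact: yl.
split; first by have /= := xyl 0%N isT; rewrite subn1.
by apply/IHl => i; apply: (xyl i.+1).
Qed.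

Lemma type_seq_walk {s t m} (x : state s t) (u : m.+1.-tuple (state s t)) :
  type_seq x u = (thead u == x) && walk x (behead u).
Proof.
case/tupleP: u => z u; rewrite /type_seq theadE /=.
case: eqP => //= ->; apply/forallP/(walkP x) => [xu i lt_iu|xu i].
  have lt_im : (i < m)%N by rewrite size_tuple in lt_iu.
  have /existsP[j] := xu (Ordinal lt_im).
  rewrite /= size_tuple => xyj; apply/existsP; exists j.
  by move: xyj; rewrite (_ : (m.+1 - i.+1 + 1)%N = (m - i.+1).+2); last lia.
have lt_im : (i < m)%N by [].
have := xu i; rewrite size_tuple => /(_ lt_im) /existsP[j xyj].
apply/existsP; exists j; move: xyj.
by rewrite (_ : (m.+1 - i.+1 + 1)%N = (m - i.+1).+2); last lia.
Qed.

(** Removing the prescribed first state turns an admissible sequence into a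
    walk; walks are then counted by their first step. *)
Lemma card_type_seq {s t} m (x : state s t) :
  #|[pred u : m.+1.-tuple (state s t) | type_seq x u]| = nwalks m x.
Proof.
transitivity #|[pred u : m.-tuple (state s t) | walk x u]|.
  have cons_inj : injective (fun u : m.-tuple (state s t) => [tuple of x :: u]).
    by move=> u w /(congr1 val) [] /val_inj.
  rewrite -(fintype.card_image cons_inj); apply: eq_card => u; rewrite inE type_seq_walk.
  case/tupleP: u => z u; rewrite theadE /=.
  apply/andP/fintype.imageP => [[/eqP -> xu]|[w xw /(congr1 val) [-> /val_inj ->]]].
    by exists u.
  by rewrite eqxx.
elim: m x => [|m IHm] x /=.
  rewrite (eq_card (B := predT)) => [|u]; last by rewrite !inE tuple0.
  by rewrite card_tuple.
rewrite -sum1_card (partition_big (fun u : m.+1.-tuple _ => thead u) (step m x)).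
  apply: eq_bigr => y xy; rewrite -IHm sum1_card.
  have cons_inj : injective (fun u : m.-tuple (state s t) => [tuple of y :: u]).
    by move=> u w /(congr1 val) [] /val_inj.
  rewrite -(fintype.card_image cons_inj); apply: eq_card => u.
  case/tupleP: u => z u; rewrite [LHS]unfold_in [in LHS]inE theadE /= [in LHS]size_tuple.
  apply/andP/fintype.imageP => [[/andP[_ zu] /eqP <-]|[w yw /(congr1 val) [-> /val_inj ->]]].
    by exists u.
  by rewrite xy eqxx.
by move=> u; case/tupleP: u => z u; rewrite theadE inE /= size_tuple => /andP[].
Qed.

(** * Positive eigenfunctions *)

Definition positive_eigenfunction {R : realType} {s t : nat} (lam : R)
    (v : state s t -> R) : Prop :=
  (forall x, 0 < v x) /\ (forall x, \sum_(y | edge x y) v y = lam * v x).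

(** The matrix and v are real, so the real part of the eigenvector equation is
    the equation for Re a, without a separate argument that a is real. *)
Lemma right_eigenvector_positive_eigenfunction {R : realType} {s t : nat}
    (a : R[i]) (v : state s t -> R) :
  (forall x, 0 < v x) -> right_eigenvector a v ->
  positive_eigenfunction (complex.Re a) v.
Proof.
move=> v_gt0 [_ Mv]; split=> // x.
have := congr1 (fun V : 'cV__ => complex.Re (V (enum_rank x) 0)) Mv.
rewrite !mxE /= enum_rankK; case: a {Mv} => a b /=; rewrite mulr0 subr0 => <-.
rewrite [in LHS]big_mkcond /=.
rewrite (big_morph (@complex.Re R) (id1 := 0) (op1 := +%R)) //; last first.
  by case=> ? ? [].
rewrite (reindex (enum_val (A := {: state s t}))); last first.
  exact/onW_bij/enum_val_bij.
apply: eq_bigr => j _; rewrite !mxE enum_rankK.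
by case: edge; rewrite /= ?mul1r ?mul0r ?mulr0 ?subr0.
Qed.

Section PositiveEigenfunction.
Context {R : realType} {s t : nat} {lam : R} {v : state s t -> R}.
Context (lam_v : positive_eigenfunction lam v).

Let v_gt0 x : 0 < v x. Proof. by case: lam_v. Qed.
Let v_ge0 x : 0 <= v x. Proof. exact: ltW. Qed.
Let sum_v x : \sum_(y | edge x y) v y = lam * v x. Proof. by case: lam_v. Qed.

Lemma sum_T_edge x :
  \sum_(k < t.+1) \sum_(z | is_T k.+1 x z) v z = \sum_(y | edge x y) v y.
Proof.
rewrite (exchange_big_dep xpredT) //= [RHS]big_mkcond; apply: eq_bigr => z _.
case: ifP => [/existsP[k xzk]|/existsP no_edge].
  rewrite (big_pred1 k) // => l /=; apply/idP/eqP => [xzl|-> //].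
  exact: is_T_index_uniq xzl xzk.
by rewrite big_pred0 // => k; apply/negP => xzk; apply: no_edge; exists k.
Qed.

Lemma Kstar_edge {x y} : edge x y -> Kstar v x y = v y / (lam * v x).
Proof. by move=> xy; rewrite /Kstar xy sum_T_edge sum_v. Qed.

Lemma le_edge {x y} : edge x y -> v y <= lam * v x.
Proof.
by move=> xy; rewrite -sum_v (bigD1 y) //= lerDl sumr_ge0.
Qed.

(** The graph has a loop at the zero state. *)
Lemma eigenvalue_ge1 : 1 <= lam.
Proof.
have [x x0 Dx] := ex_lower (state0 s t).
suff xE : x = state0 s t.
  by rewrite xE in x0; have := le_edge x0; rewrite -{1}[v _]mul1r ler_pM2r.
by apply: eq_state => i lt_it; rewrite Dx // entry_state0.
Qed.

(** Evaluated where v is maximal, the eigenvector equation bounds lam by the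
    outdegree. *)
Lemma eigenvalue_le : lam <= t.+1%:R.
Proof.
case: (@arg_maxP _ _ _ (state0 s t) xpredT v isT) => x _ x_max.
rewrite -(ler_pM2r (v_gt0 x)) -sum_v -sum_T_edge.
apply: (@le_trans _ _ (\sum_(k < t.+1) v x)); last first.
  by rewrite sumr_const card_ord mulr_natl.
apply: ler_sum => k _.
have [y xy|no_T] := pickP (fun y => is_T k.+1 x y); last by rewrite big_pred0.
rewrite (big_pred1 y) => [|z /=]; first exact: x_max.
by apply/idP/eqP => [xz|-> //]; apply: is_T_target_uniq xz xy.
Qed.

Let lam_ge0 : 0 <= lam.
Proof. exact: le_trans ler01 eigenvalue_ge1. Qed.

(** Along t moves T_1, the state loses its entries one by one. *)
Lemma le_state0 x : v (state0 s t) <= lam ^+ t * v x.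
Proof.
suff shift k : (k <= t)%N -> forall z : state s t,
    (forall i, (k <= i)%N -> entry z i = 0%N) -> v (state0 s t) <= lam ^+ k * v z.
  by apply: (shift t) => // i; apply: entry_default.
elim: k => [|k IHk] le_kt z z_zero.
  suff -> : z = state0 s t by rewrite mul1r.
  by apply: eq_state => i _; rewrite z_zero // entry_state0.
have [y zy Dy] := ex_shift z.
have y_zero i : (k <= i)%N -> entry y i = 0%N.
  move=> le_ki; have [lt_it|/entry_default -> //] := ltnP i t.
  by rewrite Dy // z_zero.
apply: le_trans (IHk (ltnW le_kt) y y_zero) _.
by rewrite exprSr -mulrA ler_wpM2l ?exprn_ge0 // le_edge // (step_edge (zy 0%N)).
Qed.

(** Going backwards from y by lowering its nonzero entries reaches the zero state
    after s steps, since the entries are at most s. *)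
Lemma state0_le y : v y <= lam ^+ s * v (state0 s t).
Proof.
suff lower k : forall z : state s t,
    (forall i, (entry z i <= k)%N) -> v z <= lam ^+ k * v (state0 s t).
  by apply: lower => i; apply: entry_le_s.
elim: k => [|k IHk] z z_le.
  suff -> : z = state0 s t by rewrite mul1r.
  by apply: eq_state => i _; rewrite entry_state0; have := z_le i; lia.
have [x xz Dx] := ex_lower z.
have x_le i : (entry x i <= k)%N.
  have [lt_it|/entry_default -> //] := ltnP i t.
  by rewrite Dx //; have := z_le i; lia.
apply: le_trans (le_edge xz) _.
by rewrite exprS -mulrA ler_wpM2l // IHk.
Qed.

Lemma eigenfunction_ratio_le x y : v y <= t.+1%:R ^+ (s + t) * v x.
Proof.
apply: le_trans (state0_le y) _.
rewrite exprD -mulrA; apply: ler_pM => //; first exact: exprn_ge0.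
  by rewrite lerXn2r ?nnegrE ?eigenvalue_le.
apply: le_trans (le_state0 x) _.
by rewrite ler_wpM2r // lerXn2r ?nnegrE ?eigenvalue_le.
Qed.

(** Both sides are summed over successors when m increases, and the admissible
    successors are among all the successors. *)
Lemma nwalks_le {c} m x :
  (forall y, c <= v y) -> (nwalks m x)%:R * c <= lam ^+ m * v x.
Proof.
move=> c_le; elim: m x => [|m IHm] x /=; first by rewrite !mul1r.
rewrite natr_sum mulr_suml exprSr -mulrA -sum_v mulr_sumr.
apply: (@le_trans _ _ (\sum_(y | step m x y) lam ^+ m * v y)).
  exact: ler_sum.
rewrite [leRHS]big_mkcond [leLHS]big_mkcond; apply: ler_sum => y _.
case: ifP => [/step_edge -> //|_]; case: ifP => // _.
by rewrite mulr_ge0 ?exprn_ge0.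
Qed.

Lemma nwalks_gt0 m (x : state s t) : (0 < nwalks m x)%N.
Proof.
elim: m x => // m IHm x /=; have [y xy _] := ex_shift x.
by rewrite (bigD1 y) //= ltn_addr.
Qed.

(** For m <= t the right-hand side absorbs lam ^ m because there is at least
    one walk and lam <= t + 1. From then on every edge is admissible at the
    first step, and the induction runs as in [nwalks_le]. *)
Lemma nwalks_ge {c} m x :
  (forall y, v y <= c) ->
  lam ^+ m * v x <= (nwalks m x)%:R * (t.+1%:R ^+ t * c).
Proof.
move=> v_le; have c_ge0 : 0 <= c by apply: le_trans (v_le x).
elim: m x => [|m IHm] x; [|have [lt_mt|le_tm] := ltnP m t].
- rewrite !mul1r; apply: le_trans (v_le x) _.
  by rewrite ler_peMl // exprn_ege1 // ler1n.
- apply: (@le_trans _ _ (t.+1%:R ^+ t * c)); last first.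
    by rewrite ler_peMl ?mulr_ge0 ?exprn_ge0 // ler1n nwalks_gt0.
  apply: ler_pM => //; first exact: exprn_ge0.
  apply: (@le_trans _ _ (t.+1%:R ^+ m.+1)).
    by rewrite lerXn2r ?nnegrE ?eigenvalue_le.
  by rewrite ler_weXn2l // ler1n.
- rewrite /= natr_sum mulr_suml exprSr -mulrA -sum_v mulr_sumr.
  rewrite (eq_bigl _ _ (fun y => step_eq_edge x y (leqW le_tm))).
  exact: ler_sum.
Qed.

(** * The density *)

Lemma mu_tilde_walk {m} {u : m.+1.-tuple (state s t)} :
  type_seq (state0 s t) u ->
  mu_tilde v u =
    v (nth (state0 s t) u m) / (lam ^+ m * v (state0 s t)).
Proof.
case/andP => u0 /forallP /= u_steps; rewrite /mu_tilde /markov_law u0 mul1r /=.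
have edge_u (i : 'I_m) :
    edge (nth (state0 s t) u i) (nth (state0 s t) u i.+1).
  by have /existsP[j /andP[_ uj]] := u_steps i; apply/existsP; exists j.
rewrite (eq_bigr (fun i : 'I_m => lam^-1 * (v (nth (state0 s t) u i.+1) /
                                  v (nth (state0 s t) u i)))); last first.
  by move=> i _; rewrite Kstar_edge // invfM mulrCA.
rewrite big_split /= prodr_const card_ord.
rewrite -(big_mkord xpredT (fun i => v (nth (state0 s t) u i.+1) /
                                     v (nth (state0 s t) u i))).
case: m u u0 {u_steps edge_u} => [|m] u /eqP u0.
  by rewrite big_geq // u0 !mul1r divff ?gt_eqF.
rewrite GRing.telescope_prodf // => [|k _]; last by rewrite gt_eqF.
by rewrite u0 invfM exprVn mulrCA.
Qed.

Lemma log_density_le {m} {u : m.+1.-tuple (state s t)} :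
  type_seq (state0 s t) u ->
  0 < mu_tilde v u /\
  `| ln (mu_star R u / mu_tilde v u) |
     <= ln (t.+1%:R ^+ (s + t) * t.+1%:R ^+ t).
Proof.
move=> u_seq; rewrite /mu_star u_seq (mu_tilde_walk u_seq) card_type_seq.
set y := nth _ _ _; set B : R := t.+1%:R; set D := B ^+ (s + t).
have B_ge1 : 1 <= B by rewrite ler1n.
have D_gt0 : 0 < D by rewrite exprn_gt0 // ltr0n.
have E_gt0 : 0 < D * B ^+ t by rewrite mulr_gt0 ?exprn_gt0 ?ltr0n.
have lam_gt0 : 0 < lam by apply: lt_le_trans eigenvalue_ge1.
have num_gt0 : 0 < lam ^+ m * v (state0 s t) by rewrite mulr_gt0 ?exprn_gt0.
have N_gt0 : 0 < (nwalks m (state0 s t))%:R :> R by rewrite ltr0n nwalks_gt0.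
split; first by rewrite divr_gt0.
set N : R := _%:R in N_gt0 *.
have den_gt0 : 0 < N * v y by rewrite mulr_gt0.
rewrite (_ : _ / _ = lam ^+ m * v (state0 s t) / (N * v y)); last first.
  by rewrite invf_div invfM mulrCA mulrA.
set r := _ / _; have r_gt0 : 0 < r by rewrite divr_gt0.
have r_le : r <= D * B ^+ t.
  have := nwalks_ge m (state0 s t) (fun z => eigenfunction_ratio_le y z).
  rewrite ler_pdivrMr // -/B -/D -/N => /le_trans -> //.
  by rewrite (mulrCA N) (mulrCA N) mulrA [_ * D]mulrC.
have r_ge : (D * B ^+ t)^-1 <= r.
  have v_ge z : D^-1 * v y <= v z.
    by rewrite ler_pdivrMl // eigenfunction_ratio_le.
  have := nwalks_le m (state0 s t) v_ge; rewrite -/N mulrCA => N_le.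
  apply: (@le_trans _ _ D^-1); last by rewrite ler_pdivlMr.
  by rewrite lef_pV2 ?posrE // ler_peMr ?exprn_ege1 // ltW.
rewrite ler_norml ler_ln ?posrE // r_le andbT.
by rewrite -lnV ?posrE // ler_ln ?posrE // invr_gt0.
Qed.

End PositiveEigenfunction.

Theorem mainTheorem4 (R : realType) (s t : nat) (hs : (1 <= s)%N)
    (ht : (1 <= t)%N) :
  exists C : R,
    forall (v : state s t -> R) (a : R[i]),
      (forall x : state s t, 0 < v x) ->
      max_eigenvalue s t a ->
      right_eigenvector a v ->
      forall (n : nat) (x : n.-tuple (state s t)),
        (1 <= n)%N ->
        type_seq (state0 s t) x ->
        0 < mu_tilde v x /\
        `| ln (mu_star R x / mu_tilde v x) | <= C.
Proof.
exists (ln (t.+1%:R ^+ (s + t) * t.+1%:R ^+ t)) => v a v_gt0 _ Mv [//|m] x _.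
exact/log_density_le/right_eigenvector_positive_eigenfunction/Mv.
Qed.
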